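(* Let $\mathcal{V}=(\mathcal{V},\otimes,k)$ be a commutative unital quantale which is completely distributive, such that $\{u\in\mathcal{V}\mid u\lll k\}$ is directed, and such that for every $u\in\mathcal{V}$ the map $\hom(u,-)\colon(\mathcal{V},\xi)\to(\mathcal{V},\xi)$ is continuous. Then the Hausdorff functor $\mathsf{H}\colon\mathcal{V}\text{-}\mathsf{CatCH}\to\mathcal{V}\text{-}\mathsf{CatCH}$ sends Priestley spaces to Priestley spaces, that is, it restricts to a functor $\mathsf{H}\colon\mathcal{V}\text{-}\mathsf{Priest}\to\mathcal{V}\text{-}\mathsf{Priest}$.
   Context: A commutative unital quantale is a complete lattice $\mathcal{V}$ with a commutative monoid structure $(\otimes,k)$ such that each $u\otimes-$ preserves suprema; $\hom(u,-)$ is its right adjoint: $v\le\hom(u,w)\iff u\otimes v\le w$. The totally below relation is: $u\lll v$ iff for every $S\subseteq\mathcal{V}$ with $v\le\bigvee S$ there is $s\in S$ with $u\le s$. $\mathcal{V}$ is completely distributive iff $v=\bigvee\{u\mid u\lll v\}$ for all $v$. A $\mathcal{V}$-category $(X,a)$ is a set $X$ with $a\colon X\times X\to\mathcal{V}$ such that $k\le a(x,x)$ and $a(x,y)\otimes a(y,z)\le a(x,z)$; a $\mathcal{V}$-functor $f\colon(X,a)\to(Y,b)$ is a map with $a(x,y)\le b(f(x),f(y))$. Let $\mathsf{U}$ be the ultrafilter functor on sets; compact Hausdorff topologies on $X$ are identified with their convergence maps $\alpha\colon\mathsf{U}X\to X$. The map $\xi\colon\mathsf{U}\mathcal{V}\to\mathcal{V}$,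 $\xi(\mathfrak{v})=\bigwedge_{A\in\mathfrak{v}}\bigvee A$, is the convergence of a compact Hausdorff topology on $\mathcal{V}$ (the Lawson topology). For a $\mathcal{V}$-category $(X,a)$ put $\mathsf{U}(X,a)=(\mathsf{U}X,\widehat{\mathsf{U}}a)$ with $\widehat{\mathsf{U}}a(\mathfrak{x},\mathfrak{y})=\bigvee\{\xi(\mathsf{U}a(\mathfrak{w}))\mid\mathfrak{w}\in\mathsf{U}(X\times X),\ \mathsf{U}\pi_1(\mathfrak{w})=\mathfrak{x},\ \mathsf{U}\pi_2(\mathfrak{w})=\mathfrak{y}\}$. A $\mathcal{V}$-categorical compact Hausdorff space $(X,a,\alpha)$ is a $\mathcal{V}$-category $(X,a)$ with a compact Hausdorff topology $\alpha$ on $X$ such that $\alpha\colon\mathsf{U}(X,a)\to(X,a)$ is a $\mathcal{V}$-functor; it is known that this is equivalent to continuity of $a\colon(X,\alpha)\times(X,\alpha)\to(\mathcal{V},\xi_\le)$, where $\xi_\le$ is the topology on $\mathcal{V}$ generated by the sets $\{u\in\mathcal{V}\mid v\nleq u\}$ ($v\in\mathcal{V}$). The category $\mathcal{V}\text{-}\mathsf{CatCH}$ has these as objects and the maps that are both continuous and $\mathcal{V}$-functors as morphisms. For $A\subseteq X$ put $\uparrow\! A=\{y\mid k\le\bigvee_{x\in A}a(x,y)\}$ and $\downarrow\! A=\{y\mid k\le\bigvee_{x\in A}a(y,x)\}$. $A$ is increasing (decreasing) if $A=\uparrow\! A$ ($A=\downarrow\! A$), and co-increasing (co-decreasing) if its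 complement is increasing (decreasing). The Hausdorff functor $\mathsf{H}$ sends $(X,a,\alpha)$ to $\mathsf{H}X=\{A\subseteq X\mid A\text{ closed and increasing}\}$ with structure $\mathsf{H}a(A,B)=\bigwedge_{y\in B}\bigvee_{x\in A}a(x,y)$ and the hit-and-miss topology, generated by the sets $V^\Diamond=\{A\in\mathsf{H}X\mid A\cap V\neq\varnothing\}$ ($V$ open, co-increasing) and $W^\Box=\{A\in\mathsf{H}X\mid A\subseteq W\}$ ($W$ open, co-decreasing); it sends $f\colon X\to Y$ to $\mathsf{H}f\colon A\mapsto\uparrow\! f(A)$. (This is a well-defined endofunctor of $\mathcal{V}\text{-}\mathsf{CatCH}$.) $\mathcal{V}^{\mathrm{op}}$ denotes the $\mathcal{V}$-categorical compact Hausdorff space with underlying set $\mathcal{V}$, structure $(u,v)\mapsto\hom(v,u)$ and topology $\xi$. An object $X=(X,a,\alpha)$ of $\mathcal{V}\text{-}\mathsf{CatCH}$ is Priestley if the cone of all morphisms $\psi\colon X\to\mathcal{V}^{\mathrm{op}}$ in $\mathcal{V}\text{-}\mathsf{CatCH}$ is point-separating and initial with respect to the forgetful functor to compact Hausdorff spaces, i.e. $a(x,y)=\bigwedge_\psi\hom(\psi(y),\psi(x))$ for all $x,y\in X$. $\mathcal{V}\text{-}\mathsf{Priest}$ is the full subcategory of $\mathcal{V}\text{-}\mathsf{CatCH}$ of Priestley spaces. *)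

(* Defs.v *)
From HB Require Import structures.
From mathcomp Require Import all_boot all_order finmap.
From mathcomp Require Import all_classical.
From mathcomp Require Import topology.

Set Implicit Arguments.
Unset Strict Implicit.
Unset Printing Implicit Defensive.

Import Order.TTheory.
Local Open Scope order_scope.
Local Open Scope classical_set_scope.

HB.mixin Record POrder_isQuantale d V of Order.POrder d V := {
  qsup : set V -> V;
  qsupP : forall S : set V, supremums S (qsup S);
  qunit : V;
  qtens : V -> V -> V;
  qtensA : associative qtens;
  qtensC : commutative qtens;
  qtens1 : left_id qunit qtens;
  qtens_sup : forall (u : V) (S : set V),
    qtens u (qsup S) = qsup [set qtens u v | v in S];
}.

#[short(type="quantaleType")]
HB.structure Definition Quantale d :=
  {V of Order.POrder d V & POrder_isQuantale d V}.

Section QuantaleDefs.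
Context {d : Order.disp_t} {V : quantaleType d}.
Implicit Types (u v w : V) (S : set V).

Definition qinf S : V := qsup (lbound S).

(* The right adjoint of [qtens u]; see [qhomP]. *)
Definition qhom u w : V := qsup [set v | qtens u v <= w].

Definition totally_below u v : Prop :=
  forall S, v <= qsup S -> exists2 s, S s & u <= s.

Definition directed S : Prop :=
  S !=set0 /\ forall u v, S u -> S v -> exists w, [/\ S w, u <= w & v <= w].

(* Ultrafilters are set systems satisfying the class [UltraFilter]; the functor
   U acts on maps by [f @ F]. *)
Definition xi (F : set_system V) : V := qinf [set qsup A | A in F].

End QuantaleDefs.

Notation "u <<< v" := (totally_below u v) (at level 70, no associativity).

HB.mixin Record Quantale_isCompletelyDistributive d V of Quantale d V := {
  qsup_totally_below : forall v : V, v = qsup [set u : V | totally_below u v];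
}.

#[short(type="cdQuantaleType")]
HB.structure Definition CDQuantale d :=
  {V of Quantale d V & Quantale_isCompletelyDistributive d V}.

Section QuantaleTheory.
Context {d : Order.disp_t} {V : quantaleType d}.
Implicit Types (u v w : V) (S T : set V).

Lemma qsup_ub S u : S u -> u <= qsup S.
Proof. by have [+ _] := qsupP S; exact. Qed.

Lemma qsup_le S u : (forall v, S v -> v <= u) -> qsup S <= u.
Proof. by move=> Su; have [_] := qsupP S; apply. Qed.

Lemma qinf_lb S u : S u -> qinf S <= u.
Proof. by move=> Su; apply: qsup_le => v; exact. Qed.

Lemma qinf_ge S u : (forall v, S v -> u <= v) -> u <= qinf S.
Proof. by move=> Su; apply: qsup_ub. Qed.

Lemma le_qsup S T : S `<=` T -> qsup S <= qsup T.
Proof. by move=> ST; apply: qsup_le => v /ST; exact: qsup_ub. Qed.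

Lemma qsup2 u v : u <= v -> qsup [set x | x = u \/ x = v] = v.
Proof.
move=> uv; apply/le_anti/andP; split; last by apply: qsup_ub; right.
by apply: qsup_le => x [->|->].
Qed.

Lemma qtens_le u v w : v <= w -> qtens u v <= qtens u w.
Proof.
move=> vw; have -> : qtens u w = qtens u (qsup [set x | x = v \/ x = w]).
  by rewrite qsup2.
by rewrite qtens_sup; apply: qsup_ub; exists v => //; left.
Qed.

Lemma qtens_le2 u u' v v' : u <= u' -> v <= v' -> qtens u v <= qtens u' v'.
Proof.
move=> uu' vv'; apply: le_trans (qtens_le u' vv').
by rewrite ![qtens _ v]qtensC; exact: qtens_le.
Qed.

Lemma qtensr1 u : qtens u qunit = u.
Proof. by rewrite qtensC qtens1. Qed.

Lemma qhomP u v w : v <= qhom u w <-> qtens u v <= w.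
Proof.
split=> [vw|]; last exact: qsup_ub.
apply: le_trans (qtens_le u vw) _.
by rewrite qtens_sup; apply: qsup_le => _ [x ux <-].
Qed.

Lemma qtens_hom u w : qtens u (qhom u w) <= w.
Proof. exact/qhomP. Qed.

Lemma totally_below_le u v : u <<< v -> u <= v.
Proof.
move=> uv; have [|s ->//] := uv [set v].
exact: qsup_ub.
Qed.

Lemma totally_below_ler u v w : u <<< v -> v <= w -> u <<< w.
Proof. by move=> uv vw S wS; apply: uv; exact: le_trans wS. Qed.

Lemma totally_below_lel u v w : u <= v -> v <<< w -> u <<< w.
Proof.
move=> uv vw S /vw[s Ss vs]; exists s => //; exact: le_trans vs.
Qed.

End QuantaleTheory.

Definition lawson d (V : quantaleType d) : Type := V.

Section LawsonTopology.
Context {d : Order.disp_t} {V : quantaleType d}.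

HB.instance Definition _ := Choice.on (lawson V).

(* A compact Hausdorff topology is recovered from its convergence map: a set is
   open iff it belongs to every ultrafilter converging to one of its points.
   That [xi] is indeed the convergence of this topology is [lawson_cvgE]. *)
Definition lawson_open : set_system (lawson V) :=
  [set A | forall F : set_system V, UltraFilter F -> A (xi F) -> F A].

Let lawson_openT : lawson_open setT.
Proof. by move=> F FU _; exact: filterT. Qed.

Let lawson_openI : setI_closed lawson_open.
Proof.
by move=> A B oA oB F FU [Ax Bx]; apply: filterI; [exact: oA | exact: oB].
Qed.

Let lawson_open_bigU (I : Type) (f : I -> set (lawson V)) :
  (forall i, lawson_open (f i)) -> lawson_open (\bigcup_i f i).
Proof.
move=> oF F FU [i _ fi]; apply: filterS (oF i F FU fi).
by move=> x fx; exists i.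
Qed.

HB.instance Definition _ := isOpenTopological.Build (lawson V)
  lawson_openT lawson_openI lawson_open_bigU.

Lemma lawson_openE (A : set (lawson V)) : open A = lawson_open A.
Proof. by []. Qed.

End LawsonTopology.

Section VCategories.
Context {d : Order.disp_t} {V : quantaleType d}.

Definition is_vcat (X : Type) (a : X -> X -> V) : Prop :=
  (forall x, qunit <= a x x) /\
  (forall x y z, qtens (a x y) (a y z) <= a x z).

Definition is_vfunctor (X Y : Type) (a : X -> X -> V) (b : Y -> Y -> V)
    (f : X -> Y) : Prop :=
  forall x y, a x y <= b (f x) (f y).

(* The structure of U(X, a). *)
Definition ultra_ext (X : Type) (a : X -> X -> V) (F G : set_system X) : V :=
  qsup [set xi ((fun p => a p.1 p.2) @ W) | W in
    [set W : set_system (X * X) |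
      [/\ UltraFilter W, fst @ W = F & snd @ W = G]]].

(* The convergence map alpha : UX -> X is a V-functor from U(X, a) to (X, a).
   On a compact Hausdorff space, [F --> x] means alpha F = x. *)
Definition conv_vfunctor (X : topologicalType) (a : X -> X -> V) : Prop :=
  forall (F G : set_system X) (x y : X), UltraFilter F -> UltraFilter G ->
    F --> x -> G --> y -> ultra_ext a F G <= a x y.

Definition up (X : Type) (a : X -> X -> V) (A : set X) : set X :=
  [set y | qunit <= qsup [set a x y | x in A]].

Definition down (X : Type) (a : X -> X -> V) (A : set X) : set X :=
  [set y | qunit <= qsup [set a y x | x in A]].

Definition increasing (X : Type) (a : X -> X -> V) (A : set X) := A = up a A.
Definition decreasing (X : Type) (a : X -> X -> V) (A : set X) := A = down a A.

End VCategories.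

Record vcatch d (V : quantaleType d) := VCatCH {
  vspace :> topologicalType;
  vdist : vspace -> vspace -> V;
  vdist_vcat : is_vcat vdist;
  vspace_compact : compact [set: vspace];
  vspace_hausdorff : hausdorff_space vspace;
  vdist_conv : conv_vfunctor vdist;
}.
Arguments vdist {d V} v _ _.

Record vcatch_mor d (V : quantaleType d) (X Y : vcatch V) := VCatCHMor {
  vmap :> X -> Y;
  vmap_continuous : continuous vmap;
  vmap_vfunctor : is_vfunctor (vdist X) (vdist Y) vmap;
}.

Record hyper d (V : quantaleType d) (X : vcatch V) := Hyper {
  hset : set X;
  hset_closed : closed hset;
  hset_increasing : increasing (vdist X) hset;
}.

Section HitMiss.
Context {d : Order.disp_t} {V : quantaleType d} (X : vcatch V).

Definition hit (U : set X) : set (hyper X) := [set A | hset A `&` U !=set0].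
Definition miss (U : set X) : set (hyper X) := [set A | hset A `<=` U].

Definition hit_miss_subbase : set_system (hyper X) := [set O |
  (exists U : set X, [/\ open U, increasing (vdist X) (~` U) & O = hit U]) \/
  (exists U : set X, [/\ open U, decreasing (vdist X) (~` U) & O = miss U])].

HB.instance Definition _ := gen_eqMixin (hyper X).
HB.instance Definition _ := gen_choiceMixin (hyper X).
HB.instance Definition _ :=
  isSubBaseTopological.Build (hyper X) hit_miss_subbase id.

Definition hyper_dist (A B : hyper X) : V :=
  qinf [set qsup [set vdist X x y | x in hset A] | y in hset B].

End HitMiss.

Section Ultrafilters.

Lemma filter_meet (T : Type) (F : set_system T) (A B : set T) :
  ProperFilter F -> F A -> F B -> exists x, A x /\ B x.
Proof. by move=> FP FA FB; exact: filter_ex (filterI FA FB). Qed.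

Lemma ultra_map (T U : Type) (f : T -> U) (F : set_system T) :
  UltraFilter F -> UltraFilter (f @ F).
Proof.
move=> FU; split=> [|G GP FG]; first exact: fmap_proper_filter.
apply/seteqP; split=> // A GA.
have [//|FA] := in_ultra_setVsetC (f @^-1` A) FU.
have GnA : G (~` A) by exact: FG.
by have [? []] := filter_meet _ GA GnA.
Qed.

Lemma ultra_meets (T : Type) (F : set_system T) (A : set T) :
  UltraFilter F -> (forall B, F B -> exists2 x, B x & A x) -> F A.
Proof.
move=> FU FA; have [//|/FA[x nAx /nAx]] := in_ultra_setVsetC A FU.
by [].
Qed.

Lemma ultra_lift (T U : Type) (f : T -> U) (F : set_system U) (P : set T) :
  UltraFilter F -> F (f @` P) ->
  exists W : set_system T, [/\ UltraFilter W, W P & f @ W = F].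
Proof.
move=> FU FP.
have : ProperFilter (filter_from F (fun B => P `&` f @^-1` B)).
  apply: filter_from_proper.
    apply: filter_from_filter; first by exists (f @` P).
    move=> A B FA FB; exists (A `&` B); first exact: filterI.
    by move=> x [Px [Ax Bx]].
  move=> A FA; have [y [Ay [x Px xE]]] := filter_meet _ FA FP.
  by exists x; split=> //=; rewrite xE.
move=> /ultraFilterLemma[W [WU FW]]; exists W; split=> //.
  by apply: FW; exists (f @` P) => // x [].
have fWP := ultra_proper (UltraFilter := ultra_map f WU).
apply: (max_filter (UltraFilter := FU)) => A FA.
by apply: FW; exists A => // x [].
Qed.

Lemma continuous_ultra (S T : topologicalType) (f : S -> T) :
  (forall (F : set_system S) x, UltraFilter F -> F --> x -> f @ F --> f x) ->
  continuous f.
Proof.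
move=> fP x B fxB; apply: contrapT => nB.
have : ProperFilter (within (~` (f @^-1` B)) (nbhs x)).
  apply: Build_ProperFilter_ex => A; rewrite /within /= => xA.
  apply: contrapT => A0; apply: nB; apply: filterS xA => y yA.
  by apply: contrapT => nBy; apply: A0; exists y; exact: yA.
move=> /ultraFilterLemma[F [FU xF]].
have FB : F (f @^-1` B).
  by apply: fP fxB => A xA; apply: xF; rewrite /within /=; apply: filterS xA.
have FnB : F (~` (f @^-1` B)).
  by apply: xF; rewrite /within /=; exact: nearW.
by have [? []] := filter_meet _ FB FnB.
Qed.

Lemma closed_ultra (X : topologicalType) (C : set X) :
  (forall (F : set_system X) x, UltraFilter F -> F C -> F --> x -> C x) ->
  closed C.
Proof.
move=> CP x; rewrite closureEcvg => -[G GP [Gx CG]].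
have [F [FU GF]] := ultraFilterLemma GP.
apply: (CP F x FU); first by apply/GF/CG.
by move=> A /Gx/GF.
Qed.

Lemma closed_cvgP (X : topologicalType) (C : set X) (F : set_system X) x :
  closed C -> UltraFilter F -> F C -> F --> x -> C x.
Proof.
move=> cC FU FC Fx; apply: cC => B /Fx FB.
by have [y yCB] := filter_meet _ FC FB; exists y.
Qed.

Lemma compact_cvg (X : topologicalType) (F : set_system X) :
  compact [set: X] -> UltraFilter F -> exists x : X, F --> x.
Proof.
by rewrite compact_ultra => + FU => /(_ F FU filterT)[x [_ Fx]]; exists x.
Qed.

Lemma closed_rel_image (X : topologicalType) (R : set (X * X)) (K : set X) :
  compact [set: X] -> closed K ->
  (forall (W : set_system (X * X)) x y, UltraFilter W -> W R ->
    fst @ W --> x -> snd @ W --> y -> R (x, y)) ->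
  closed [set y | exists2 x, K x & R (x, y)].
Proof.
move=> cX cK RP; apply: closed_ultra => F y FU FR Fy.
have [|W [WU WP WF]] :=
    @ultra_lift _ _ snd F [set p | K p.1 /\ R p] FU.
  by apply: filterS FR => z [x Kx Rxz]; exists (x, z).
have fWU := ultra_map fst WU.
have WK : W (fst @^-1` K) by apply: filterS WP => p [].
have [x Wx] := compact_cvg cX fWU; exists x.
  exact: closed_cvgP cK fWU WK Wx.
apply: RP Wx _ => //; first by apply: filterS WP => p [].
by rewrite WF.
Qed.

Lemma closed_rel_preimage (X : topologicalType) (R : set (X * X)) (K : set X) :
  compact [set: X] -> closed K ->
  (forall (W : set_system (X * X)) x y, UltraFilter W -> W R ->
    fst @ W --> x -> snd @ W --> y -> R (x, y)) ->
  closed [set x | exists2 y, K y & R (x, y)].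
Proof.
move=> cX cK RP.
apply: (@closed_rel_image _ [set p | R (p.2, p.1)]) => // W x y WU WR Wx Wy.
exact: (RP ((fun p => (p.2, p.1)) @ W) y x (ultra_map _ WU)).
Qed.

End Ultrafilters.

Section CDQuantaleTheory.
Context {d : Order.disp_t} {V : cdQuantaleType d}.
Implicit Types (u v w : V).

Lemma le_totally_below u v : (forall w, w <<< u -> w <= v) -> u <= v.
Proof. by move=> uv; rewrite (qsup_totally_below u); exact: qsup_le. Qed.

Lemma totally_below_dense u v : u <<< v -> exists w, u <<< w /\ w <<< v.
Proof.
move=> uv; have [|w [w' ww' w'v] uw] :=
    uv [set w | exists2 w', w <<< w' & w' <<< v].
  apply: le_totally_below => w' w'v; apply: le_totally_below => w ww'.
  by apply: qsup_ub; exists w'.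
by exists w'; split=> //; exact: totally_below_lel ww'.
Qed.

Lemma totally_below_tens u v w : u <<< qtens v w ->
  exists v' w', [/\ v' <<< v, w' <<< w & u <= qtens v' w'].
Proof.
move=> uvw; have [|_ [v' [w' [v'v w'w ->]] uv']] :=
    uvw [set x | exists v' w', [/\ v' <<< v, w' <<< w & x = qtens v' w']].
  have tens_le (x y z : V) :
      (forall t, t <<< y -> qtens x t <= z) -> qtens x y <= z.
    move=> xyz; have -> : qtens x y = qtens x (qsup [set t | t <<< y]).
      by rewrite -qsup_totally_below.
    by rewrite qtens_sup; apply: qsup_le => _ [t ty <-]; exact: xyz.
  apply: (tens_le) => w' w'w; rewrite qtensC; apply: (tens_le) => v' v'v.
  by rewrite qtensC; apply: qsup_ub; exists v', w'.
by exists v', w'.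
Qed.

Lemma xi_ge (F : set_system V) u :
  UltraFilter F -> F [set v | u <= v] -> u <= xi F.
Proof.
move=> FU Fu; apply: qinf_ge => _ [A FA <-].
have [v [uv Av]] := filter_meet _ Fu FA.
by apply: le_trans uv _; exact: qsup_ub.
Qed.

Lemma xi_totally_below (F : set_system V) u :
  UltraFilter F -> u <<< xi F -> F [set v | u <<< v].
Proof.
move=> FU /totally_below_dense[w [uw wF]]; apply: ultra_meets => A FA.
have [|v Av wv] := wF A; first by apply: qinf_lb; exists A.
by exists v => //; exact: totally_below_ler wv.
Qed.

Lemma lawson_closed_ge u : closed [set v : lawson V | u <= v].
Proof.
rewrite -openC lawson_openE => F FU nF.
have [//|] := in_ultra_setVsetC (~` [set v : V | u <= v]) FU.
by rewrite setCK => /(xi_ge FU).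
Qed.

Lemma lawson_open_totally_below u : open [set v : lawson V | u <<< v].
Proof. by rewrite lawson_openE => F FU; exact: xi_totally_below. Qed.

Lemma lawson_hausdorff : hausdorff_space (lawson V).
Proof.
have disj (p q : lawson V) : cluster (nbhs p) q -> (p : V) <= q.
  move=> pq; apply: le_totally_below => u up; apply: contrapT => uq.
  have [||v [uv]] := pq [set v | u <<< v] (~` [set v : V | u <= v]).
  - by apply: open_nbhs_nbhs; split=> //; exact: lawson_open_totally_below.
  - apply: open_nbhs_nbhs; split=> //.
    by apply: closed_openC; exact: lawson_closed_ge.
  - by apply; exact: totally_below_le.
move=> p q pq; apply/le_anti/andP; split; apply: disj => // A B qA pB.
by rewrite setIC; exact: pq.
Qed.

Lemma lawson_cvg_xi (F : set_system V) :
  UltraFilter F -> F --> (xi F : lawson V).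
Proof.
move=> FU A; rewrite nbhsE => -[B [oB Bx] BA].
by apply: filterS BA _; move: oB; rewrite lawson_openE; apply.
Qed.

Lemma lawson_cvgE (F : set_system V) (v : lawson V) :
  UltraFilter F -> F --> v <-> xi F = v.
Proof.
move=> FU; split=> [Fv|<-]; last exact: lawson_cvg_xi.
exact: cvg_unique lawson_hausdorff _ _ _ _ (lawson_cvg_xi FU) Fv.
Qed.

Lemma lawson_compact : compact [set: lawson V].
Proof.
rewrite compact_ultra => F FU _; exists (xi F).
by split=> //; exact: lawson_cvg_xi.
Qed.

(* The two directions of the characterization of [conv_vfunctor] by closedness
   of the sets [set p | u <= a p.1 p.2]. *)
Lemma conv_vfunctorP (X : topologicalType) (a : X -> X -> V) u
    (W : set_system (X * X)) (x y : X) :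
  conv_vfunctor a -> UltraFilter W -> W [set p | u <= a p.1 p.2] ->
  fst @ W --> x -> snd @ W --> y -> u <= a x y.
Proof.
move=> aP WU Wu Wx Wy.
apply: le_trans (aP _ _ x y (ultra_map _ WU) (ultra_map _ WU) Wx Wy).
apply: (le_trans (y := xi ((fun p => a p.1 p.2) @ W))).
  by apply: xi_ge => //; exact: ultra_map.
by apply: qsup_ub; exists W.
Qed.

Lemma conv_vfunctorI (X : topologicalType) (a : X -> X -> V) :
  (forall u (W : set_system (X * X)) (x y : X), UltraFilter W ->
    W [set p | u <= a p.1 p.2] -> fst @ W --> x -> snd @ W --> y ->
    u <= a x y) ->
  conv_vfunctor a.
Proof.
move=> aP F G x y FU GU Fx Gy; apply: qsup_le => _ [W [WU WF WG] <-].
apply: le_totally_below => u /xi_totally_below => /(_ (ultra_map _ WU)) uW.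
have {}uW : W [set p | u <= a p.1 p.2].
  by apply: (@filterS _ W _ _ _ _ uW) => p; exact: totally_below_le.
by apply: (aP u W) => //; rewrite ?WF ?WG.
Qed.

Definition vop_dist (u v : lawson V) : V := qhom v u.

Lemma vop_vcat : is_vcat vop_dist.
Proof.
split=> [u|u v w]; first by apply/qhomP; rewrite qtensr1.
apply/qhomP; rewrite [qtens (vop_dist _ _) _]qtensC qtensA.
apply: le_trans (qtens_hom v u); apply: qtens_le2 => //; exact: qtens_hom.
Qed.

Lemma vop_conv : conv_vfunctor vop_dist.
Proof.
apply: conv_vfunctorI => u W p q WU Wu Wp Wq; apply/qhomP.
apply: le_totally_below => w /totally_below_tens[r [s [rq su wrs]]].
apply: le_trans wrs _.
apply: (closed_cvgP (@lawson_closed_ge (qtens r s)) (ultra_map _ WU) _ Wp).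
have Wr : W [set p | r <<< p.2].
  apply: Wq; apply: open_nbhs_nbhs; split=> //.
  exact: lawson_open_totally_below.
have : W [set p | qtens r s <= p.1]; last by [].
apply: filterS (filterI Wu Wr) => -[x y] /= [/qhomP uyx ry].
apply: le_trans uyx; apply: qtens_le2; exact: totally_below_le.
Qed.

Definition vop : vcatch V :=
  VCatCH vop_vcat lawson_compact lawson_hausdorff vop_conv.

End CDQuantaleTheory.

Section UpDown.
Context {d : Order.disp_t} {V : quantaleType d} (X : Type) (a : X -> X -> V).
Hypothesis aV : is_vcat a.

Lemma qsup_tens_le (I : Type) (A : set I) (f : I -> V) (u w : V) :
  (forall i, A i -> qtens (f i) u <= w) ->
  qtens (qsup [set f i | i in A]) u <= w.
Proof.
move=> fw; rewrite qtensC qtens_sup; apply: qsup_le => _ [_ [i Ai <-] <-].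
by rewrite qtensC; exact: fw.
Qed.

Lemma qunit_qsup_le (I : Type) (A : set I) (f : I -> V) (u w : V) :
  qunit <= qsup [set f i | i in A] ->
  (forall i, A i -> qtens (f i) u <= w) -> u <= w.
Proof.
move=> kA fw; apply: le_trans (qsup_tens_le fw).
by rewrite -{1}(qtens1 u); exact: qtens_le2.
Qed.

Lemma sub_up (A : set X) : A `<=` up a A.
Proof.
by move=> x Ax; apply: le_trans (aV.1 x) _; apply: qsup_ub; exists x.
Qed.

Lemma sub_down (A : set X) : A `<=` down a A.
Proof.
by move=> x Ax; apply: le_trans (aV.1 x) _; apply: qsup_ub; exists x.
Qed.

Lemma up_subset (A B : set X) : A `<=` B -> up a A `<=` up a B.
Proof.
move=> AB y Ay; apply: le_trans Ay _; apply: le_qsup => _ [x Ax <-].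
by exists x => //; exact: AB.
Qed.

Lemma down_subset (A B : set X) : A `<=` B -> down a A `<=` down a B.
Proof.
move=> AB y Ay; apply: le_trans Ay _; apply: le_qsup => _ [x Ax <-].
by exists x => //; exact: AB.
Qed.

Lemma up_increasing (A : set X) : increasing a (up a A).
Proof.
apply/seteqP; split; first exact: sub_up.
move=> z zA; apply: le_trans (zA) _; apply: qsup_le => _ [y Ay <-].
apply: (qunit_qsup_le Ay) => x Ax; apply: le_trans (aV.2 _ _ _) _.
by apply: qsup_ub; exists x.
Qed.

Lemma down_decreasing (A : set X) : decreasing a (down a A).
Proof.
apply/seteqP; split; first exact: sub_down.
move=> z zA; apply: le_trans (zA) _; apply: qsup_le => _ [y Ay <-].
apply: (qunit_qsup_le Ay) => x Ax; rewrite qtensC.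
by apply: le_trans (aV.2 _ _ _) _; apply: qsup_ub; exists x.
Qed.

Lemma increasingP (A : set X) : up a A `<=` A -> increasing a A.
Proof. by move=> AA; apply/seteqP; split=> //; exact: sub_up. Qed.

Lemma decreasingP (A : set X) : down a A `<=` A -> decreasing a A.
Proof. by move=> AA; apply/seteqP; split=> //; exact: sub_down. Qed.

End UpDown.

Section UpDownMap.
Context {d : Order.disp_t} {V : quantaleType d} (X Y : Type).
Context (a : X -> X -> V) (b : Y -> Y -> V) (f : X -> Y).
Hypotheses (bV : is_vcat b) (fV : is_vfunctor a b f).

Lemma up_preimage (A : set Y) : up a (f @^-1` A) `<=` f @^-1` up b A.
Proof.
move=> y Ay; apply: le_trans Ay _; apply: qsup_le => _ [x Ax <-].
by apply: le_trans (fV _ _) _; apply: qsup_ub; exists (f x).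
Qed.

Lemma down_preimage (A : set Y) : down a (f @^-1` A) `<=` f @^-1` down b A.
Proof.
move=> y Ay; apply: le_trans Ay _; apply: qsup_le => _ [x Ax <-].
by apply: le_trans (fV _ _) _; apply: qsup_ub; exists (f x).
Qed.

Lemma up_image_up (aV : is_vcat a) (A : set X) :
  up b (f @` up a A) = up b (f @` A).
Proof.
apply/seteqP; split; last first.
  apply: up_subset => _ [x Ax <-]; exists x => //; exact: sub_up.
move=> z zA; apply: le_trans (zA) _; apply: qsup_le => _ [_ [y Ay <-] <-].
apply: (qunit_qsup_le Ay) => x Ax; apply: le_trans (_ : _ <= b (f x) z) _.
  apply: le_trans (bV.2 _ (f y) _); apply: qtens_le2 => //; exact: fV.
by apply: qsup_ub; exists (f x) => //; exists x.
Qed.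

End UpDownMap.

Section CompactSeparation.
Context {d : Order.disp_t} {V : cdQuantaleType d} (X : vcatch V).
Let a := vdist X.

Lemma closed_up_ge (K : set X) u :
  closed K -> closed [set y | exists2 x, K x & u <= a x y].
Proof.
move=> cK; apply: (@closed_rel_image _ [set p | u <= a p.1 p.2]) => //.
  exact: vspace_compact.
by move=> W x y; exact: conv_vfunctorP (@vdist_conv _ _ X).
Qed.

Lemma closed_down_ge (K : set X) u :
  closed K -> closed [set x | exists2 y, K y & u <= a x y].
Proof.
move=> cK; apply: (@closed_rel_preimage _ [set p | u <= a p.1 p.2]) => //.
  exact: vspace_compact.
by move=> W x y; exact: conv_vfunctorP (@vdist_conv _ _ X).
Qed.

Lemma upE (K : set X) :
  up a K = \bigcap_(u in [set u | u <<< qunit])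
    [set y | exists2 x, K x & u <= a x y].
Proof.
apply/seteqP; split=> [y yK u /= uk|y yK].
  by have [_ [x Kx <-] ux] := uk _ yK; exists x.
apply: le_totally_below => u uk; have [x Kx ux] := yK u uk.
by apply: le_trans ux _; apply: qsup_ub; exists x.
Qed.

Lemma downE (K : set X) :
  down a K = \bigcap_(u in [set u | u <<< qunit])
    [set x | exists2 y, K y & u <= a x y].
Proof.
apply/seteqP; split=> [y yK u /= uk|y yK].
  by have [_ [x Kx <-] ux] := uk _ yK; exists x.
apply: le_totally_below => u uk; have [x Kx ux] := yK u uk.
by apply: le_trans ux _; apply: qsup_ub; exists x.
Qed.

Lemma notin_up (K : set X) y : ~ up a K y ->
  exists2 u, u <<< qunit & forall x, K x -> ~ u <= a x y.
Proof.
move=> nK; apply: contrapT => nu; apply: nK; rewrite upE => u uk.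
by apply: contrapT => nx; apply: nu; exists u => // x Kx ux; apply: nx; exists x.
Qed.

Lemma closed_up (K : set X) : closed K -> closed (up a K).
Proof.
by move=> cK; rewrite upE; apply: closed_bigI => u _; exact: closed_up_ge.
Qed.

Lemma closed_down (K : set X) : closed K -> closed (down a K).
Proof.
by move=> cK; rewrite downE; apply: closed_bigI => u _; exact: closed_down_ge.
Qed.

Lemma normal_separation (C E : set X) :
  closed C -> closed E -> C `&` E = set0 ->
  exists O, [/\ open O, C `<=` O & closure O `&` E = set0].
Proof.
move=> cC cE CE0.
have nE : set_nbhs C (~` E).
  apply/set_nbhsP; exists (~` E); split=> //; first exact: closed_openC.
  exact/disjoints_subset.
have [N /set_nbhsP[O [oO CO ON]] NE] :=
  compact_normal (@vspace_hausdorff _ _ X) (@vspace_compact _ _ X) cC nE.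
exists O; split=> //; apply/disjoints_subset.
exact: subset_trans (closureS ON) NE.
Qed.

Lemma hit_miss_separation (B : set X) (y : X) (u v v' : V) :
  closed B -> v <<< qunit -> v' <<< qunit ->
  (forall x, B x -> ~ qtens (qtens v u) v' <= a x y) ->
  exists U W : set X,
    [/\ open U, increasing a (~` U) & U y] /\
    [/\ open W, decreasing a (~` W) & B `<=` W] /\
    (forall x z, W x -> U z -> ~ u <= a x z) /\
    (u <= qunit -> forall A, A `<=` W -> up a A `&` U = set0).
Proof.
move=> cB vk v'k Bu; have aV := vdist_vcat X.
pose C := [set z | exists2 x, B x & v <= a x z].
pose D := [set z | exists2 x, [set y] x & v' <= a z x].
pose E := [set z | exists2 z', D z' & u <= a z z'].
have cC : closed C by exact: closed_up_ge.
have cD : closed D.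
  apply: closed_down_ge; apply: compact_closed; last exact: compact_set1.
  exact: vspace_hausdorff.
have cE : closed E by exact: closed_down_ge.
have CE0 : C `&` E = set0.
  rewrite -subset0 => z [[x Bx vxz] [z' [_ -> v'y] uz]].
  apply: (Bu x Bx); apply: le_trans (aV.2 x z' y); apply: qtens_le2 => //.
  by apply: le_trans (aV.2 x z z'); exact: qtens_le2.
have [O [oO CO OE0]] := normal_separation cC cE CE0.
pose W := ~` down a (~` O).
pose G := [set z | exists2 x, closure O x & u <= a x z].
pose U := ~` up a G.
have cG : closed G by apply: closed_up_ge; exact: closed_closure.
have WO : W `<=` O.
  move=> x Wx; apply: contrapT => nOx; apply: Wx; exact: sub_down.
exists U, W; split.
  split.
  - by apply: closed_openC; exact: closed_up.
  - by rewrite /U setCK; exact: up_increasing.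
  - rewrite /U upE => /(_ v' v'k)[z [x Ox ux] v'z].
    suff : (closure O `&` E) x by rewrite OE0.
    by split=> //; exists z => //; exists y.
split.
  split.
  - by apply: closed_openC; apply: closed_down; exact: open_closedC.
  - by rewrite /W setCK; exact: down_decreasing.
  - move=> x Bx; rewrite /W downE => /(_ v vk)[z nOz vz].
    by apply: nOz; apply: CO; exists x.
split=> [x z Wx Uz ux|uk A AW].
  apply: Uz; apply: sub_up => //; exists x => //.
  by apply: subset_closure; exact: WO.
rewrite -subset0 => z [zA]; apply; apply: up_subset zA => x Ax.
exists x; last exact: le_trans uk (aV.1 x).
by apply: subset_closure; apply: WO; exact: AW.
Qed.

End CompactSeparation.

Section HyperSpace.
Context {d : Order.disp_t} {V : cdQuantaleType d} (X : vcatch V).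
Let a := vdist X.

Lemma hyper_eqP (A B : hyper X) : hset A = hset B -> A = B.
Proof.
case: A B => [A cA iA] [B cB iB] /= AB; subst B.
by rewrite (Prop_irrelevance cA cB) (Prop_irrelevance iA iB).
Qed.

Lemma hyper_cvg (F : set_system (hyper X)) (A : hyper X) : UltraFilter F ->
  (forall O, hit_miss_subbase O -> O A -> F O) -> F --> A.
Proof.
move=> FU FO B; rewrite nbhsE => -[_ [[D Dsub <-] [C DC CA]] CB].
apply: filterS CB _; apply: (@filterS _ _ _ C); first by move=> ? ?; exists C.
have [E sE EC] := Dsub _ DC; rewrite -EC in CA *.
apply: filter_bigI => O OE; apply: FO; last exact: CA.
by move: (sE _ OE); rewrite inE.
Qed.

Lemma open_subbase (O : set (hyper X)) : hit_miss_subbase O -> open O.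
Proof.
move=> sO; exists [set O]; last by rewrite bigcup_set1.
move=> _ ->; exists [fset O]%fset; first by move=> P; rewrite in_fset1 => /eqP ->; exact/mem_set.
apply/seteqP; split=> A /= OA; first by apply: OA; rewrite /= in_fset1.
by move=> P; rewrite /= in_fset1 => /eqP->.
Qed.

Lemma open_hit (U : set X) : open U -> increasing a (~` U) -> open (hit U).
Proof. by move=> oU iU; apply: open_subbase; left; exists U. Qed.

Lemma open_miss (W : set X) : open W -> decreasing a (~` W) -> open (miss W).
Proof. by move=> oW dW; apply: open_subbase; right; exists W. Qed.

Lemma hyper_vcat : is_vcat (@hyper_dist _ _ X).
Proof.
have aV := vdist_vcat X; split=> [A|A B C].
  apply: qinf_ge => _ [x Ax <-]; apply: le_trans (aV.1 x) _.
  by apply: qsup_ub; exists x.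
apply: qinf_ge => _ [z Cz <-].
apply: (@le_trans _ _
  (qtens (hyper_dist A B) (qsup [set a y z | y in hset B]))).
  by apply: qtens_le; apply: qinf_lb; exists z.
rewrite qtensC; apply: qsup_tens_le => y By; rewrite qtensC.
apply: (@le_trans _ _ (qtens (qsup [set a x y | x in hset A]) (a y z))).
  by apply: qtens_le2 => //; apply: qinf_lb; exists y.
apply: qsup_tens_le => x Ax; apply: le_trans (aV.2 x y z) _.
by apply: qsup_ub; exists x.
Qed.

Lemma hyper_hausdorff : hausdorff_space (hyper X).
Proof.
have sub (A B : hyper X) : cluster (nbhs A) B -> hset A `<=` hset B.
  move=> AB x Ax; rewrite (hset_increasing B); apply: contrapT.
  move=> /notin_up[u uk nux].
  have [|v' [v [v'k vk uvv']]] := @totally_below_tens _ V u qunit qunit.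
    by rewrite qtens1.
  have [|U [W [[oU iU Ux] [[oW dW BW] [_ UW]]]]] :=
      @hit_miss_separation _ _ X (hset B) x qunit v' v
        (hset_closed (h := B)) v'k vk.
    by rewrite qtensr1 => z Bz vz; apply: (nux z) => //; exact: le_trans vz.
  have [||C [[z [Cz Uz]] CW]] := AB (hit U) (miss W).
  - by apply: open_nbhs_nbhs; split; [exact: open_hit | exists x].
  - by apply: open_nbhs_nbhs; split; [exact: open_miss|].
  - have : (up a (hset C) `&` U) z by split=> //; rewrite -hset_increasing.
    by rewrite UW.
move=> A B AB; apply: hyper_eqP; apply/seteqP; split; apply: sub => //.
by move=> P Q BP AQ; rewrite setIC; exact: AB.
Qed.

Lemma hyper_compact : compact [set: hyper X].
Proof.
have aV := vdist_vcat X.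
rewrite compact_ultra => F FU _.
pose D := [set U : set X |
  [/\ open U, increasing a (~` U) & ~ F (hit U)]].
pose L := ~` \bigcup_(U in D) U.
have cL : closed L.
  by apply: open_closedC; apply: bigcup_open => U [].
have iL : increasing a L.
  apply: (increasingP aV) => y yL [U DU Uy]; have [_ iU _] := DU.
  suff : (~` U) y by [].
  rewrite iU; apply: up_subset yL => x Lx Ux; apply: Lx.
  by exists U.
exists (Hyper cL iL); split=> //; apply: hyper_cvg => O.
move=> [[U [oU iU ->]] [x /= [Lx Ux]]|[W [oW dW ->]] /= LW].
  by apply: contrapT => nF; apply: Lx; exists U.
have [//|FnW] := in_ultra_setVsetC (miss W) FU; exfalso.
have [|T [TU TP TF]] := @ultra_lift _ _ fst F
    [set p : hyper X * X | hset p.1 p.2 /\ ~ W p.2] FU.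
  apply: filterS FnW => A /= /existsNP[x /not_implyP[Ax nWx]].
  by exists (A, x).
have [x Tx] := compact_cvg (@vspace_compact _ _ X) (ultra_map snd TU).
have nWx : (~` W) x.
  apply: closed_cvgP (ultra_map snd TU) _ Tx; first exact: open_closedC.
  by have : T (snd @^-1` (~` W)) by apply: filterS TP => p [].
have /contrapT[U [oU iU nFU] Ux] : ~ ~ (\bigcup_(U in D) U) x.
  by move=> /LW.
apply: nFU; rewrite -TF.
have TU' : T (snd @^-1` U) by apply: Tx; exact: open_nbhs_nbhs.
have : T (fst @^-1` hit U); last by [].
apply: filterS (filterI TP TU') => p [[Ap _] Up]; by exists p.2.
Qed.

Lemma hyper_conv : conv_vfunctor (@hyper_dist _ _ X).
Proof.
apply: conv_vfunctorI => u T A B TU Tu TA TB.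
apply: qinf_ge => _ [y By <-]; apply: le_totally_below => w wu.
suff [x Ax wx] : exists2 x, hset A x & w <= a x y.
  by apply: le_trans wx _; apply: qsup_ub; exists x.
apply: contrapT => nA.
have [|p [v' [pu v'k wp]]] := @totally_below_tens _ V w (qtens qunit u) qunit.
  by rewrite qtensr1 qtens1.
have [v [u' [vk u'u pvu]]] := totally_below_tens pu.
have [|U [W [[oU iU Uy] [[oW dW AW] [UW _]]]]] :=
    @hit_miss_separation _ _ X (hset A) y u' v v'
      (hset_closed (h := A)) vk v'k.
  move=> x Ax ux; apply: nA; exists x => //; apply: le_trans wp _.
  by apply: le_trans ux; exact: qtens_le2.
have TW : T (fst @^-1` miss W).
  by apply: TA; apply: open_nbhs_nbhs; split; [exact: open_miss|].
have TU' : T (snd @^-1` hit U).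
  by apply: TB; apply: open_nbhs_nbhs; split; [exact: open_hit | exists y].
have [[A' B'] /= [[uAB A'W] [z [B'z Uz]]]] :=
  filter_ex (filterI (filterI Tu TW) TU').
have [|_ [x A'x <-] u'x] := u'u [set a x z | x in hset A'].
  by apply: le_trans uAB _; apply: qinf_lb; exists z.
exact: UW (A'W _ A'x) Uz u'x.
Qed.

Definition hausdorff : vcatch V :=
  VCatCH hyper_vcat hyper_compact hyper_hausdorff hyper_conv.

End HyperSpace.

Section HausdorffMap.
Context {d : Order.disp_t} {V : cdQuantaleType d}.

Section Map.
Context (X Y : vcatch V) (f : vcatch_mor X Y).
Let a := vdist X.
Let b := vdist Y.

Lemma hyper_map_closed (A : hyper X) : closed (up b (f @` hset A)).
Proof.
apply: closed_up; apply: compact_closed; first exact: vspace_hausdorff.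
apply: continuous_compact.
  by apply: continuous_subspaceT; exact: vmap_continuous.
by apply: subclosed_compact (@vspace_compact _ _ X) _ => //; exact: hset_closed.
Qed.

Definition hyper_map (A : hyper X) : hyper Y :=
  Hyper (hyper_map_closed (A := A))
    (up_increasing (vdist_vcat Y) (f @` hset A)).

Lemma hyper_map_vfunctor :
  is_vfunctor (@hyper_dist _ _ X) (@hyper_dist _ _ Y) hyper_map.
Proof.
have bV := vdist_vcat Y.
move=> A B; apply: qinf_ge => _ [z zB <-].
apply: (qunit_qsup_le zB) => _ [y By <-]; rewrite qtensC.
apply: (@le_trans _ _ (qtens (qsup [set a x y | x in hset A]) (b (f y) z))).
  by apply: qtens_le2 => //; apply: qinf_lb; exists y.
apply: qsup_tens_le => x Ax.
apply: (@le_trans _ _ (b (f x) z)).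
  apply: le_trans (bV.2 _ (f y) _); apply: qtens_le2 => //.
  exact: vmap_vfunctor.
by apply: qsup_ub; exists (f x) => //; apply: sub_up => //; exists x.
Qed.

Lemma hyper_map_continuous : continuous hyper_map.
Proof.
have cf : forall O, open O -> open (f @^-1` O).
  by apply/continuousP; exact: vmap_continuous.
have fV := @vmap_vfunctor _ _ _ _ f.
have finc (U : set Y) : increasing b (~` U) -> increasing a (~` (f @^-1` U)).
  move=> iU; apply: (increasingP (vdist_vcat X)).
  by move=> x xU; rewrite preimage_setC iU; apply: up_preimage fV _ _ _;
    rewrite -preimage_setC.
have fdec (W : set Y) : decreasing b (~` W) -> decreasing a (~` (f @^-1` W)).
  move=> dW; apply: (decreasingP (vdist_vcat X)).
  by move=> x xW; rewrite preimage_setC dW; apply: down_preimage fV _ _ _;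
    rewrite -preimage_setC.
apply: continuous_ultra => F A FU FA; apply: hyper_cvg; first exact: ultra_map.
move=> O [[U [oU iU ->]] [y /= [yA Uy]]|[W [oW dW ->]] /= AW].
  have [x Ax Ufx] : exists2 x, hset A x & U (f x).
    apply: contrapT => nx; suff : (~` U) y by [].
    rewrite iU; apply: up_subset yA => _ [x Ax <-] Ufx.
    by apply: nx; exists x.
  have FU' : F (hit (f @^-1` U)).
    apply: FA; apply: open_nbhs_nbhs; split; last by exists x.
    by apply: open_hit; [exact: cf | exact: finc].
  have : F (hyper_map @^-1` hit U); last by [].
  apply: filterS FU' => B [z [Bz Uz]]; exists (f z); split=> //=.
  by apply: (sub_up (vdist_vcat Y)); exists z.
have [//|FnW] := in_ultra_setVsetC (hyper_map @^-1` miss W) FU; exfalso.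
have [|T [TU TP TF]] := @ultra_lift _ _ fst F
    [set p : hyper X * Y | hset (hyper_map p.1) p.2 /\ ~ W p.2] FU.
  apply: filterS FnW => B /= /existsNP[z /not_implyP[Bz nWz]].
  by exists (B, z).
have [z Tz] := compact_cvg (@vspace_compact _ _ Y) (ultra_map snd TU).
have nWz : (~` W) z.
  apply: closed_cvgP (ultra_map snd TU) _ Tz; first exact: open_closedC.
  by have : T (snd @^-1` (~` W)) by apply: filterS TP => p [].
have /notin_up[u uk nuz] : ~ up b (f @` hset A) z by move=> /AW.
have [|v' [v [v'k vk uvv']]] := @totally_below_tens _ V u qunit qunit.
  by rewrite qtens1.
have cfA : closed (f @` hset A).
  apply: compact_closed; first exact: vspace_hausdorff.
  apply: continuous_compact.
    by apply: continuous_subspaceT; exact: vmap_continuous.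
  by apply: subclosed_compact (@vspace_compact _ _ X) _ => //; exact: hset_closed.
have [|U [W' [[oU iU Uz] [[oW' dW' AW'] [_ UW']]]]] :=
    @hit_miss_separation _ _ Y (f @` hset A) z qunit v' v cfA v'k vk.
  rewrite qtensr1 => y Ay vy.
  by apply: (nuz y) => //; exact: le_trans vy.
have TU' : T (snd @^-1` U) by apply: Tz; exact: open_nbhs_nbhs.
have TW' : T (fst @^-1` miss (f @^-1` W')).
  have : F (miss (f @^-1` W')); last by rewrite -TF.
  apply: FA; apply: open_nbhs_nbhs; split.
    by apply: open_miss; [exact: cf | exact: fdec].
  by move=> x Ax; apply: AW'; exists x.
have [[B y] /= [[[yB _] Uy] BW']] := filter_ex (filterI (filterI TP TU') TW').
have : (up b (f @` hset B) `&` U) y by [].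
by rewrite UW' // => _ [x Bx <-]; exact: BW'.
Qed.

Definition hausdorff_map : vcatch_mor (hausdorff X) (hausdorff Y) :=
  @VCatCHMor _ _ (hausdorff X) (hausdorff Y) hyper_map
    hyper_map_continuous hyper_map_vfunctor.

End Map.

Lemma hausdorff_map_id (X : vcatch V) (f : vcatch_mor X X) :
  vmap f =1 id -> hausdorff_map f =1 id.
Proof.
move=> fid A; apply: hyper_eqP => /=.
by rewrite (funext fid) image_id -hset_increasing.
Qed.

Lemma hausdorff_map_comp (X Y Z : vcatch V) (f : vcatch_mor X Y)
    (g : vcatch_mor Y Z) (h : vcatch_mor X Z) :
  vmap h =1 vmap g \o vmap f ->
  hausdorff_map h =1 hausdorff_map g \o hausdorff_map f.
Proof.
move=> hgf A; apply: hyper_eqP => /=; rewrite (funext hgf) -image_comp.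
apply/seteqP; split.
  apply: up_subset => _ [_ [x Ax <-] <-]; exists (f x) => //.
  by apply: (sub_up (vdist_vcat Y)); exists x.
move=> z zA; apply: le_trans (zA) _; apply: qsup_le => _ [_ [y Ay <-] <-].
apply: (qunit_qsup_le Ay) => w fAw.
apply: (@le_trans _ _ (vdist Z (g w) z)); last first.
  by apply: qsup_ub; exists (g w) => //; exists w.
apply: le_trans (proj2 (vdist_vcat Z) _ (g y) _).
by apply: qtens_le2 => //; exact: vmap_vfunctor.
Qed.

End HausdorffMap.

(* Point-separation and initiality of the cone of all morphisms from X to V^op.
   Priestley spaces form a full subcategory, so [hausdorff] restricts to it as
   soon as it preserves [is_priestley]. *)
Definition is_priestley d (V : cdQuantaleType d) (X : vcatch V) : Prop :=
  (forall x y : X, (forall psi : vcatch_mor X vop, psi x = psi y) -> x = y) /\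
  (forall x y : X, vdist X x y =
    qinf [set qhom (psi y) (psi x) | psi in [set: vcatch_mor X vop]]).

(* Main.v *)
Require Import Defs.
From mathcomp Require Import all_boot all_order.
From mathcomp Require Import all_classical.
From mathcomp Require Import topology.

(** Morphisms [psi : X -> V^op] are the continuous maps with
    [psi y (x) a x y <= psi x].  The proof shows that the morphisms
    [A |-> \/_(x in A) psi x] on the Hausdorff space [H X], one for each [psi],
    already separate points and are initial ([sup_mor]).

    Everything rests on one inequality ([sup_mor_initial]): for [A] closed and
    [y : X], if [t <= hom (psi y) (\/_A psi)] for every [psi], then
    [t <= \/_(x in A) a x y].  By complete distributivity it is enough to find,
    for each [u <<< t], a single [x] in [A] with [u <= a x y].  Consider the
    closed sets [{x in A | u <= psi x}], where [psi] ranges over the morphisms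
    with [k <= psi y].  Each is nonempty, because [u <<< t <= \/_A psi], and
    they form a filter base, because morphisms are closed under binary meets
    ([meet_mor]).  Compactness yields a point [x] common to all of them.  An
    arbitrary [psi] is brought to the normalized form [k <= psi y] by replacing
    it with [hom (psi y) (psi _)], a morphism because [hom (psi y) _] is
    continuous ([hom_mor]); hence [u <= hom (psi y) (psi x)] for all [psi],
    that is [u <= a x y], as [X] is Priestley.

    The inequality makes the cone on [H X] initial.  Point separation follows:
    two closed increasing sets with the same images are at distance at least
    [k] in both directions, hence contain each other. *)

Set Implicit Arguments.
Unset Strict Implicit.
Unset Printing Implicit Defensive.

Import Order.TTheory.
Local Open Scope order_scope.
Local Open Scope classical_set_scope.

(** * Convergence and morphisms into [V^op] *)

Section Morphisms.
Context {d : Order.disp_t} {V : cdQuantaleType d}.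
Implicit Types (u v w : V).

(** The limit of an ultrafilter in the Lawson topology is the join of the
    elements whose principal up-set it contains, so convergence can be tested
    by order-theoretic bounds on both sides. *)
Lemma lawson_cvgP (F : set_system V) (v : lawson V) : UltraFilter F ->
  (forall w, w <<< v -> F [set z | w <= z]) ->
  (forall w, F [set z | w <<< z] -> w <= v) ->
  F --> v.
Proof.
move=> FU vF Fv; apply/lawson_cvgE; apply/le_anti/andP; split.
  by apply: le_totally_below => w /xi_totally_below; exact: Fv.
by apply: le_totally_below => w /vF; exact: xi_ge.
Qed.

Definition qmeet u v : V := qinf [set z | z = u \/ z = v].

Lemma le_qmeet w u v : w <= qmeet u v <-> w <= u /\ w <= v.
Proof.
split=> [wuv|[wu wv]]; last by apply: qinf_ge => z [->|->].
by split; apply: le_trans wuv _; apply: qinf_lb; [left | right].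
Qed.

Variable X : vcatch V.
Implicit Types (psi phi : vcatch_mor X (@vop d V)) (x y : X).

Lemma vop_mor_tens psi x y : qtens (psi y) (vdist X x y) <= (psi x : V).
Proof. by apply/qhomP; exact: (@vmap_vfunctor _ _ _ _ psi x y). Qed.

Lemma vop_vfunctor (f : X -> V) :
  (forall x y, qtens (f y) (vdist X x y) <= f x) ->
  is_vfunctor (vdist X) (vdist (@vop d V)) f.
Proof. by move=> fX x y; apply/qhomP. Qed.

Lemma vop_mor_ge_closed psi u : closed [set x | u <= (psi x : V)].
Proof.
have /continuous_closedP := @vmap_continuous _ _ _ _ psi.
by move=> /(_ [set v : V | u <= v]); apply; exact: (@lawson_closed_ge d V u).
Qed.

Lemma vop_mor_below_open psi u : open [set x | u <<< (psi x : V)].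
Proof.
have /continuousP := @vmap_continuous _ _ _ _ psi.
move=> /(_ [set v : V | u <<< v]); apply.
exact: (@lawson_open_totally_below d V u).
Qed.

(** The constant at the top element is the meet of the empty family: it starts
    the filter base used in [sup_mor_initial]. *)
Lemma top_vfunctor :
  is_vfunctor (vdist X) (vdist (@vop d V)) (fun=> qsup [set: V]).
Proof. by apply: vop_vfunctor => x y; exact: qsup_ub. Qed.

Lemma top_continuous : continuous ((fun=> qsup [set: V]) : X -> @vop d V).
Proof. by move=> x; exact: cvg_cst. Qed.

Definition top_mor := VCatCHMor top_continuous top_vfunctor.

Section Meet.
Context (psi phi : vcatch_mor X (@vop d V)).

Definition meet_fun (x : X) : vop := qmeet (psi x) (phi x).

(** Belonging to an up-set is a conjunctive condition on a meet, so both bounds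
    of [lawson_cvgP] reduce to the convergence of the two factors. *)
Lemma meet_continuous : continuous meet_fun.
Proof.
apply: continuous_ultra => F x FU Fx.
apply: (@lawson_cvgP (meet_fun @ F)); first exact: ultra_map.
  move=> w wx.
  have below (chi : vcatch_mor X vop) :
      meet_fun x <= (chi x : V) -> F [set z | w <<< (chi z : V)].
    move=> xchi; apply: Fx; apply: open_nbhs_nbhs; split.
      exact: vop_mor_below_open.
    exact: totally_below_ler xchi.
  have [wpsi wphi] := (le_qmeet (meet_fun x) (psi x) (phi x)).1 (lexx _).
  have : F [set z | w <= meet_fun z]; last by [].
  apply: filterS (filterI (below _ wpsi) (below _ wphi)) => z [w1 w2].
  by apply/le_qmeet; split; exact: totally_below_le.
move=> w Fw; apply/le_qmeet.
have {}Fw : F [set z | w <= (psi z : V) /\ w <= (phi z : V)].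
  by apply: (@filterS _ F _ _ _ _ Fw) => z /totally_below_le/le_qmeet.
split.
- apply: (closed_cvgP (@vop_mor_ge_closed psi w) FU _ Fx).
  by apply: filterS Fw => z [].
- apply: (closed_cvgP (@vop_mor_ge_closed phi w) FU _ Fx).
  by apply: filterS Fw => z [].
Qed.

Lemma meet_vfunctor : is_vfunctor (vdist X) (vdist (@vop d V)) meet_fun.
Proof.
apply: vop_vfunctor => x y; apply/le_qmeet.
have [ypsi yphi] := (le_qmeet (meet_fun y) (psi y) (phi y)).1 (lexx _).
by split; apply: le_trans (vop_mor_tens _ x y); apply: qtens_le2.
Qed.

Definition meet_mor := VCatCHMor meet_continuous meet_vfunctor.

End Meet.

Section Hom.
Context (u : V) (hom_continuous : continuous (qhom u : lawson V -> lawson V)).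
Context (psi : vcatch_mor X (@vop d V)).

Definition hom_fun (x : X) : vop := qhom u (psi x).

Lemma hom_fun_continuous : continuous hom_fun.
Proof.
move=> x; apply: (@continuous_comp X (lawson V) (lawson V) psi (qhom u)).
  exact: (@vmap_continuous _ _ _ _ psi x).
exact: hom_continuous.
Qed.

Lemma hom_vfunctor : is_vfunctor (vdist X) (vdist (@vop d V)) hom_fun.
Proof.
apply: vop_vfunctor => x y; apply/qhomP; rewrite qtensA.
apply: le_trans (vop_mor_tens psi x y).
by apply: qtens_le2; first exact: qtens_hom.
Qed.

Definition hom_mor := VCatCHMor hom_fun_continuous hom_vfunctor.

End Hom.

(** * Joins of a morphism over closed increasing sets *)

Section Sup.
Context (psi : vcatch_mor X (@vop d V)).

Definition sup_on (A : set X) : V := qsup [set (psi x : V) | x in A].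

Definition sup_fun (A : hausdorff X) : vop := sup_on (hset A).

Lemma ge_set_decreasing u : decreasing (vdist X) [set x | u <= (psi x : V)].
Proof.
apply: (decreasingP (vdist_vcat X)) => z zC /=.
apply: (qunit_qsup_le zC) => x ux; rewrite qtensC.
by apply: le_trans (vop_mor_tens psi z x); exact: qtens_le2.
Qed.

(** A point [z] with [u <<< psi z] leaves room for some [w] in between, which
    absorbs the loss incurred when [k <= \/_x a x z] only provides, for each
    [v <<< k], a point [x] with [v <= a x z]. *)
Lemma not_below_set_increasing u :
  increasing (vdist X) (~` [set x | u <<< (psi x : V)]).
Proof.
apply: (increasingP (vdist_vcat X)) => z; rewrite upE => zC /= uz.
have [w [uw wz]] := totally_below_dense uz.
have [|p [v [pz vk wpv]]] := @totally_below_tens _ V w (psi z) qunit.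
  by rewrite qtensr1.
have [x nux vx] := zC v vk; apply: nux; apply: totally_below_ler uw _.
apply: le_trans wpv _; apply: le_trans (vop_mor_tens psi x z).
by apply: qtens_le2 => //; exact: totally_below_le.
Qed.

(** The lower bound is a hit condition and the upper bound a miss condition:
    both up-sets of [V] in question pull back along [psi] to sets allowed in
    the subbase. *)
Lemma sup_continuous : continuous sup_fun.
Proof.
apply: continuous_ultra => F A FU FA.
apply: (@lawson_cvgP (sup_fun @ F)); first exact: ultra_map.
  move=> w /totally_below_dense[w' [ww' w'A]].
  have [_ [x Ax <-] w'x] := w'A _ (lexx _).
  have : F (hit (X := X) [set x | w <<< (psi x : V)]).
    apply: FA; apply: open_nbhs_nbhs; split.
      by apply: open_hit; [exact: vop_mor_below_open|
                           exact: not_below_set_increasing].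
    by exists x; split=> //; exact: totally_below_ler w'x.
  apply: (@filterS _ F) => B [z [Bz wz]] /=.
  by apply: le_trans (totally_below_le wz) _; apply: qsup_ub; exists z.
move=> w Fw; have {}Fw : F [set B | w <<< sup_on (hset B)] by [].
apply: contrapT => wA.
have Fmiss : F (miss (X := X) (~` [set x | w <= (psi x : V)])).
  apply: FA; apply: open_nbhs_nbhs; split.
    apply: open_miss; first by apply: closed_openC; exact: vop_mor_ge_closed.
    by rewrite setCK; exact: ge_set_decreasing.
  move=> x Ax /= wx; apply: wA; apply: le_trans wx _.
  by apply: qsup_ub; exists x.
have [B [wB BW]] := filter_meet _ Fw Fmiss.
by have [_ [x Bx <-] wx] := wB _ (lexx _); exact: BW wx.
Qed.

Lemma sup_on_tens (A : set X) y :
  qtens (psi y) (qsup [set vdist X x y | x in A]) <= sup_on A.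
Proof.
rewrite qtensC; apply: qsup_tens_le => x Ax; rewrite qtensC.
by apply: le_trans (vop_mor_tens psi x y) _; apply: qsup_ub; exists x.
Qed.

Lemma sup_vfunctor :
  is_vfunctor (vdist (hausdorff X)) (vdist (@vop d V)) sup_fun.
Proof.
move=> A B; apply/qhomP; apply: qsup_tens_le => y By.
apply: le_trans (sup_on_tens (hset A) y); apply: qtens_le.
by apply: qinf_lb; exists y.
Qed.

Definition sup_mor : vcatch_mor (hausdorff X) (@vop d V) :=
  VCatCHMor sup_continuous sup_vfunctor.

End Sup.

(** * Initiality *)

Section Initial.
Hypothesis hom_continuous :
  forall u : V, continuous (qhom u : lawson V -> lawson V).
Hypothesis X_initial : forall x y : X, vdist X x y =
  qinf [set qhom (psi y : V) (psi x : V) |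
         psi in [set: vcatch_mor X (@vop d V)]].

(** By compactness of [A], a single [x] serves for all [psi] at once: it is the
    limit of an ultrafilter containing every [{x in A | u <= psi x}] with
    [k <= psi y]. *)
Lemma sup_mor_initial (A : set X) y t : closed A ->
  (forall psi, t <= qhom (psi y : V) (sup_on psi A)) ->
  t <= qsup [set vdist X x y | x in A].
Proof.
move=> cA tA; apply: le_totally_below => u ut.
suff [x Ax ux] : exists2 x, A x & u <= vdist X x y.
  by apply: le_trans ux _; apply: qsup_ub; exists x.
pose D := [set psi : vcatch_mor X (@vop d V) | qunit <= (psi y : V)].
pose S (psi : vcatch_mor X (@vop d V)) : set X :=
  A `&` [set x | u <= (psi x : V)].
have /ultraFilterLemma[F [FU SF]] : ProperFilter (filter_from D S).
  apply: filter_from_proper => [|psi kpsi].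
    apply: filter_from_filter; first by exists top_mor; exact: qsup_ub.
    move=> psi phi kpsi kphi; exists (meet_mor psi phi); first exact/le_qmeet.
    by move=> x [Ax /= /le_qmeet[]]; split.
  have [|_ [x Ax <-] ux] := ut [set (psi x : V) | x in A]; last by exists x.
  apply: le_trans (qtens_hom (psi y) _).
  apply: le_trans (qtens_le2 kpsi (tA psi)).
  by rewrite qtens1.
have FS psi : D psi -> F (S psi) by move=> Dpsi; apply: SF; exists psi.
have [x Fx] := compact_cvg (@vspace_compact _ _ X) FU.
exists x.
  apply: (closed_cvgP cA FU _ Fx).
  have Dtop : D top_mor by exact: qsup_ub.
  by apply: filterS (FS _ Dtop) => z [].
rewrite X_initial; apply: qinf_ge => _ [psi _ <-].
(* [hom (psi y) psi] is the normalization of [psi] at [y]. *)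
pose phi := hom_mor (@hom_continuous (psi y)) psi.
apply: (closed_cvgP (@vop_mor_ge_closed phi u) FU _ Fx).
have Dphi : D phi by apply/qhomP; rewrite qtensr1.
by apply: filterS (FS _ Dphi) => z [].
Qed.

Lemma hausdorff_initial (A B : hausdorff X) : vdist (hausdorff X) A B =
  qinf [set qhom (Psi B : V) (Psi A : V) |
         Psi in [set: vcatch_mor (hausdorff X) (@vop d V)]].
Proof.
apply/le_anti/andP; split.
  by apply: qinf_ge => _ [Psi _ <-]; exact: (@vmap_vfunctor _ _ _ _ Psi A B).
apply: qinf_ge => _ [y By <-].
apply: sup_mor_initial => [|psi]; first exact: hset_closed.
apply/qhomP; apply: le_trans (qtens_hom (sup_mor psi B) _).
apply: qtens_le2; first by apply: qsup_ub; exists y.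
by apply: qinf_lb; exists (sup_mor psi).
Qed.

End Initial.

Lemma hyper_dist_subset (A B : hyper X) :
  qunit <= hyper_dist A B -> hset B `<=` hset A.
Proof.
move=> kAB y By; rewrite (hset_increasing A); apply: le_trans kAB _.
by apply: qinf_lb; exists y.
Qed.

End Morphisms.

Theorem mainTheorem8 (d : Order.disp_t) (V : cdQuantaleType d)
  (unit_directed : directed [set u : V | u <<< qunit])
  (hom_continuous : forall u : V,
    continuous (qhom u : lawson V -> lawson V)) :
  forall X : vcatch V, is_priestley X -> is_priestley (hausdorff X).
Proof.
move=> X [_ X_initial].
have HX_initial := hausdorff_initial hom_continuous X_initial.
split; last exact: HX_initial.
have sub (A B : hausdorff X) :
    (forall Psi : vcatch_mor (hausdorff X) vop, Psi A = Psi B) ->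
    hset B `<=` hset A.
  move=> AB; apply: hyper_dist_subset.
  have -> : hyper_dist A B = vdist (hausdorff X) A B by [].
  rewrite HX_initial; apply: qinf_ge => _ [Psi _ <-].
  by apply/qhomP; rewrite AB qtensr1.
move=> A B AB; apply: hyper_eqP; apply/seteqP.
by split; apply: sub => // Psi; rewrite AB.
Qed.
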